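(* Let $\Gamma$ be a metrized graph that is a tree with $v$ vertices, each edge of length $1$. Then $$W(\Gamma)=(v-1)^2+\#\big\{\{e_{i_1},e_{i_2},e_{i_3}\}\subset E(\Gamma):\ e_{i_1},e_{i_2},e_{i_3}\text{ all lie on some path in }\Gamma\big\},$$ and, when $v\ge 4$, this also equals $$(v-1)^2+\#\big\{S\subset E(\Gamma):\ \#S=v-4,\ \text{contracting the edges of }S\text{ yields the path graph }P_4\big\}.$$
   Context: A metrized graph is a finite connected graph each of whose edges is identified with a closed segment of positive length, with a finite vertex set $V(\Gamma)$ containing every point of valence $\neq 2$; $E(\Gamma)$ is its edge set and $v=\#V(\Gamma)$. The Wiener index is $W(\Gamma)=\frac12\sum_{p,q\in V(\Gamma)}d(p,q)$ with $d$ the path distance. Contracting an edge means shrinking it to a point (identifying its end points). $P_4$ denotes the path graph with $4$ vertices and $3$ edges in a line (here with unit edge lengths). A path in $\Gamma$ is a simple path of edges in the tree. *)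

(* Defs.v *)
From mathcomp Require Import all_boot.
Set Implicit Arguments. Unset Strict Implicit. Unset Printing Implicit Defensive.

Section Graph.
Variable T : finType.
Variable e : rel T.

Definition simple_graph := symmetric e /\ irreflexive e.

Definition edges : {set {set T}} := [set [set p.1; p.2] | p in [set p : T * T | e p.1 p.2]].

Definition is_cycle (x : T) (p : seq T) : bool :=
  [&& path e x p, uniq (x :: p), 2 <= size p & e (last x p) x].

Definition is_tree : Prop :=
  simple_graph /\ 0 < #|T| /\ (forall x y, connect e x y) /\
  (forall x p, ~~ is_cycle x p).

Fixpoint reachN (n : nat) (x : T) : {set T} :=
  if n is n'.+1 then
    reachN n' x :|: [set z | [exists y in reachN n' x, e y z]]
  else [set x].

(* graph (path) distance with unit edge lengths: least n with y reachable
   from x in <= n steps (defaults to #|T| if unreachable) *)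
Definition gdist (x y : T) : nat :=
  find (fun n => y \in reachN n x) (iota 0 #|T|).

Definition wiener : nat :=
  \sum_(x : T) \sum_(y : T | enum_rank x < enum_rank y) gdist x y.

Definition walk_edges (x : T) (p : seq T) : {set {set T}} :=
  [set:: pairmap (fun a b => [set a; b]) x p].

(* the set S of edges all lie on some (simple) path of Gamma; a simple path
   has at most #|T| vertices, so it is a tuple of size n.+1 with n < #|T| *)
Definition on_some_path (S : {set {set T}}) : bool :=
  [exists n : 'I_#|T|, [exists t : (n.+1).-tuple T,
     [&& path e (thead t) (behead t), uniq t &
         S \subset walk_edges (thead t) (behead t)]]].

(* contracting the edges of S (S a subset of E) yields P_4 (vertices 0-1-2-3,
   edges {0,1},{1,2},{2,3}): the vertices of the contracted (multi)graph are the
   connected components of the subgraph with edge set S, its edges are the edges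
   of E \ S; it is isomorphic to P_4 iff there is a labelling f of the vertices
   of Gamma by 'I_4 whose fibres are exactly these components and which maps the
   edges of E \ S bijectively onto the three edges of P_4. *)
Definition contracts_to_P4 (S : {set {set T}}) : bool :=
  let eS := [rel x y | e x y && ([set x; y] \in S)] in
  [exists f : {ffun T -> 'I_4},
    [&& [forall x, forall y, (f x == f y) == connect eS x y],
        #|edges :\: S| == 3 &
        [set f @: (E0 : {set T}) | E0 in edges :\: S] ==
          [set [set (inord 0 : 'I_4); inord 1];
               [set (inord 1 : 'I_4); inord 2];
               [set (inord 2 : 'I_4); inord 3]] ]].

End Graph.

(* Main.v *)
Require Import Defs.
From mathcomp Require Import all_boot.
From mathcomp Require Import zify.
Set Implicit Arguments. Unset Strict Implicit. Unset Printing Implicit Defensive.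

(* Write [sep x y] for the set of edges whose removal disconnects x from y. In
   a tree [sep x y] is the edge set of the simple path from x to y, it satisfies
   [sep x z = sep x y (+) sep y z] (symmetric difference), and its cardinality is
   d(x,y).
   A triple S of edges on some path has exactly one unordered pair {x,y} such that
   S is contained in [sep x y] and contains both end edges of that path; conversely
   a pair {x,y} arises from max(d(x,y) - 2, 0) triples, one for each interior edge.
   Hence the number of triples plus v(v-1) is W plus the number v-1 of adjacent
   pairs (for which d - 2 is negative), which is the first formula.
   The second formula follows by taking complements S |-> E \ S: if the three edges
   of F = E \ S lie on the path from x to y, then z |-> #|sep x z :&: F| is a
   labelling of the contraction by P_4; conversely, given a labelling, the edge over
   {i, i+1} separates the vertices labelled <= i from the others, so every edge of F
   separates a vertex labelled 0 from one labelled 3. *)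

(** * Edge sets of walks *)

Lemma walk_edges_cons (T : finType) (x y : T) (p : seq T) :
  walk_edges x (y :: p) = [set x; y] |: walk_edges y p.
Proof. by apply/setP=> E; rewrite !inE. Qed.

Lemma walk_edges_cat (T : finType) (x : T) (p q : seq T) :
  walk_edges x (p ++ q) = walk_edges x p :|: walk_edges (last x p) q.
Proof.
elim: p x => [|y p IH] x /=; last by rewrite !walk_edges_cons IH setUA.
by apply/setP=> E; rewrite !inE.
Qed.

Lemma mem_walk_edges (T : finType) (x z : T) (p : seq T) (E : {set T}) :
  E \in walk_edges x p -> z \in E -> z \in x :: p.
Proof.
elim: p x => [|y p IH] x; first by rewrite inE.
rewrite walk_edges_cons in_setU1 => /orP[/eqP->|].
  by rewrite !inE => /orP[/eqP->|/eqP->]; rewrite eqxx ?orbT.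
by move=> Ep /(IH _ Ep); rewrite [in X in _ -> X]inE => ->; rewrite orbT.
Qed.

(** * Edges that separate two vertices of a tree *)

Section Separation.

Variables (T : finType) (e : rel T).

Definition cut (E : {set T}) : rel T :=
  [rel a b | e a b && ([set a; b] != E)].

Definition sep (x y : T) : {set {set T}} :=
  [set E in edges e | ~~ connect (cut E) x y].

Hypothesis tree_e : is_tree e.

Lemma tree_sym : symmetric e. Proof. by case: tree_e => -[]. Qed.
Lemma tree_irr : irreflexive e. Proof. by case: tree_e => -[]. Qed.
Lemma tree_connect x y : connect e x y. Proof. by case: tree_e => _ [] _ []. Qed.

Lemma edgesP (E : {set T}) :
  reflect (exists x y, e x y /\ E = [set x; y]) (E \in edges e).
Proof.
apply: (iffP imsetP) => [[[x y]]|[x [y [exy ->]]]].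
  by rewrite inE /= => exy ->; exists x, y.
by exists (x, y); rewrite ?inE.
Qed.

Lemma mem_edges x y : e x y -> [set x; y] \in edges e.
Proof. by move=> exy; apply/edgesP; exists x, y. Qed.

Lemma cut_csym E : connect_sym (cut E).
Proof. by apply: sym_connect_sym => a b; rewrite /cut /= tree_sym setUC. Qed.

(** A simple path from [u] to [w] avoiding the edge would close up with it to a cycle. *)
Lemma tree_bridge u w : e u w -> ~~ connect (cut [set u; w]) u w.
Proof.
move=> euw; apply/negP=> /connectP[p cp lw].
case/shortenP: cp lw => q cq uq _ lw.
have eq_ : path e u q by apply: sub_path cq => a b /andP[].
case: tree_e => _ [_ [_ /(_ u q)/negP]]; apply.
rewrite /is_cycle eq_ uq -lw tree_sym euw andbT /=.
(* [is_cycle] asks for at least two further vertices: an empty [q] gives a loop, and a [q] of length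
   one is the removed edge itself. *)
case: q {uq eq_} cq lw => [|a [|b q]] //=.
  by move=> _ wu; move: euw; rewrite wu tree_irr.
by move=> /andP[/andP[_ /negP nE] _] wa; case: nE; rewrite wa.
Qed.

(** The vertices still reachable from [u] or [w] are closed under adjacency, since the only missing
    edge joins [u] to [w]; connectedness of the tree does the rest. *)
Lemma cut_sides u w x :
  connect (cut [set u; w]) u x || connect (cut [set u; w]) w x.
Proof.
set C := cut _.
have clA : closed e [pred z | connect C u z || connect C w z].
  apply: intro_closed => [|a b eab]; first exact: sym_connect_sym tree_sym.
  rewrite !inE; have [ab|nab] := eqVneq [set a; b] [set u; w].
    have: b \in [set u; w] by rewrite -ab !inE eqxx orbT.
    by rewrite !inE => /orP[] /eqP-> _; rewrite connect0 ?orbT.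
  have Cab : connect C a b by apply: connect1; rewrite /C /cut /= eab.
  by case/orP=> [ua|wa]; apply/orP; [left|right]; exact: connect_trans Cab.
by have := closed_connect clA (tree_connect u x); rewrite !inE connect0 /= => <-.
Qed.

(** Removing an edge leaves exactly two sides, so being separated means that two Boolean side labels
    differ, and such differences add modulo 2. *)
Lemma sep_addb E x y z : (E \in sep x z) = (E \in sep x y) (+) (E \in sep y z).
Proof.
rewrite !inE; case: (E \in edges e) / edgesP => //= -[u [w [euw ->]]].
have sC := cut_csym [set u; w].
have tr a b (h : connect (cut [set u; w]) a b) := same_connect sC h.
have side a b : connect (cut [set u; w]) a b =
    (connect (cut [set u; w]) u a == connect (cut [set u; w]) u b).
  have [ua|nua] := boolP (connect _ u a); first by rewrite -(tr _ _ ua); case: connect.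
  have:= cut_sides u w a; rewrite (negPf nua) /= => wa.
  rewrite -(tr _ _ wa); have [ub|nub] := boolP (connect _ u b).
    by rewrite sC -(tr _ _ ub) (negPf (tree_bridge euw)).
  by have:= cut_sides u w b; rewrite (negPf nub).
by rewrite (side x) (side x y) (side y); do 3 case: (connect _ u _).
Qed.

Lemma sep_sym x y : sep x y = sep y x.
Proof. by apply/setP=> E; rewrite !inE (cut_csym E). Qed.

Lemma sep_refl x : sep x x = set0.
Proof. by apply/setP=> E; rewrite !inE connect0 andbF. Qed.

Lemma sep_edge x y : e x y -> sep x y = [set [set x; y]].
Proof.
move=> exy; apply/setP=> E; rewrite !inE.
have [->|nE] := eqVneq E [set x; y]; first by rewrite mem_edges // tree_bridge.
apply/negbTE; rewrite negb_and negbK orbC connect1 //= /cut /=.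
by rewrite exy eq_sym.
Qed.

(** By induction with [sep_addb]: on a simple path the first edge does not recur, so the symmetric
    difference is a disjoint union. *)
Lemma sep_path x p : path e x p -> uniq (x :: p) ->
  sep x (last x p) = walk_edges x p /\ #|walk_edges x p| = size p.
Proof.
elim: p x => [|y p IH] x /=.
  by rewrite sep_refl; split; [apply/setP=> E; rewrite !inE|
     apply/eqP; rewrite cards_eq0; apply/eqP/setP=> E; rewrite !inE].
move=> /andP[exy pp] /andP[nx uq]; have [IH1 IH2] := IH y pp uq.
have nxy : [set x; y] \notin walk_edges y p.
  by apply: contra nx => /mem_walk_edges; apply; rewrite !inE eqxx.
rewrite walk_edges_cons cardsU1 nxy IH2; split=> //.
apply/setP=> E; rewrite (sep_addb E x y) IH1 sep_edge // in_set1 in_setU1.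
by have [->|] := eqVneq E [set x; y]; first rewrite (negPf nxy).
Qed.

Lemma simple_path x y : exists p, [/\ path e x p, uniq (x :: p) & y = last x p].
Proof.
have /connectP[p pp ->] := tree_connect x y.
by case/shortenP: pp => q pq uq _; exists q.
Qed.

(** The vertex [z] lies on the simple path from [x] to [y], whose initial segment up to [z] is the
    path from [x] to [z]. *)
Lemma sub_sep_mem x y z E : E \in sep x y -> z \in E -> sep x z \subset sep x y.
Proof.
have [p [pp up ->]] := simple_path x y.
have [-> _] := sep_path pp up => Ep zE.
have /splitPl zp := mem_walk_edges Ep zE.
case: zp pp up => p1 p2 lp1; rewrite cat_path -cat_cons cat_uniq.
move=> /andP[pp1 _] /andP[up1 _].
by rewrite -lp1 (sep_path pp1 up1).1 walk_edges_cat subsetUl.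
Qed.

Lemma edge_memP E z : E \in edges e -> z \in E ->
  exists2 u, e u z & E = [set u; z].
Proof.
case/edgesP=> a [b [eab ->]]; rewrite !inE => /orP[]/eqP->.
  by exists b; rewrite 1?tree_sym // setUC.
by exists a.
Qed.

Lemma sep_edges x y : sep x y \subset edges e.
Proof. by apply/subsetP=> E; rewrite inE => /andP[]. Qed.

Lemma sep_end_ex x y : x != y -> exists2 E, E \in sep x y & y \in E.
Proof.
have [[|u p] [pp up ->]] := simple_path y x; first by rewrite eqxx.
move=> _; exists [set y; u]; last by rewrite !inE eqxx.
by rewrite sep_sym (sep_path pp up).1 walk_edges_cons setU11.
Qed.

(** Write E = {u, y}. Another such edge E' would lie on the path from [x] to [u], which would then
    pass through [y] and contain E; but E already separates [u] from [y], so it cannot separate [x]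
    from [u]. *)
Lemma sep_end_uniq x y E E' : E \in sep x y -> y \in E ->
  E' \in sep x y -> y \in E' -> E = E'.
Proof.
move=> Es yE Es' yE'; apply/eqP; apply: contraT => nE.
have [u euy Eu] := edge_memP (subsetP (sep_edges x y) _ Es) yE.
have uy := sep_edge euy.
have: E' \in sep x u.
  by have := Es'; rewrite (sep_addb _ x u) uy -Eu in_set1 eq_sym (negPf nE) addbF.
move=> /sub_sep_mem/(_ yE')/subsetP/(_ _ Es).
by have := Es; rewrite (sep_addb _ x u) uy -Eu in_set1 eqxx addbT => /negPf->.
Qed.

Lemma sep_eq0 x y : (sep x y == set0) = (x == y).
Proof.
have [->|/sep_end_ex[E Es _]] := eqVneq x y; first by rewrite sep_refl eqxx.
by apply/negbTE/set0Pn; exists E.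
Qed.

(** * Distance, connectivity and paths in terms of [sep] *)

Lemma card_sep_lt x y : #|sep x y| < #|T|.
Proof.
have [p [pp up ->]] := simple_path x y.
have [-> ->] := sep_path pp up.
by have := max_card (mem (x :: p)); rewrite (card_uniqP up).
Qed.

(** One step along an edge enlarges [sep] by at most one element; conversely, stepping back from [y]
    across the last edge of the path removes one. *)
Lemma reachN_sep n x y : (y \in reachN e n x) = (#|sep x y| <= n).
Proof.
elim: n y => [|n IH] y /=.
  by rewrite leqn0 cards_eq0 sep_eq0 in_set1 eq_sym.
rewrite !inE IH; apply/orP/idP => [[|/existsP[z]]|].
- exact: leqW.
- rewrite IH => /andP[zn ezy]; apply: leq_trans (_ : #|sep x z :|: sep z y| <= _).
    apply/subset_leq_card/subsetP=> E; rewrite (sep_addb _ x z) in_setU.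
    by case: (_ \in _) (_ \in _) => -[].
  by rewrite (leq_trans (leq_card_setU _ _)) // (sep_edge ezy) cards1 addn1.
rewrite leq_eqVlt => /orP[/eqP En|]; last by left.
right; have nxy : x != y by rewrite -sep_eq0 -cards_eq0 En.
have [E Es yE] := sep_end_ex nxy.
have [u euy Eu] := edge_memP (subsetP (sep_edges x y) _ Es) yE.
apply/existsP; exists u; rewrite IH euy andbT -ltnS -En.
apply/proper_card/properP; split.
  by apply: sub_sep_mem Es _; rewrite Eu !inE eqxx.
exists E => //; have := Es.
by rewrite (sep_addb _ x u) (sep_edge euy) -Eu in_set1 eqxx addbT.
Qed.

(** The search in [gdist] stops at #|T|; [card_sep_lt] ensures that the true distance is found
    before this bound. *)
Lemma gdist_sep x y : gdist e x y = #|sep x y|.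
Proof.
rewrite /gdist.
have -> : find (fun n => y \in reachN e n x) (iota 0 #|T|)
        = find (leq #|sep x y|) (iota 0 #|T|).
  by apply: eq_find => n; rewrite reachN_sep.
have lt := card_sep_lt x y; rewrite -(subnKC (ltnW lt)) iotaD find_cat add0n.
have -> : has (leq #|sep x y|) (iota 0 #|sep x y|) = false.
  by apply/negbTE/hasPn=> n; rewrite mem_iota -ltnNge.
rewrite size_iota; case: (_ - _) (lt) => [|k] /=; rewrite ?leqnn ?addn0 //.
Qed.


(** This describes the fibres of a contraction: two vertices are merged exactly when every edge of
    the path between them is contracted. *)
Lemma connect_sub_sep (S : {set {set T}}) x y :
  connect [rel a b | e a b && ([set a; b] \in S)] x y = (sep x y \subset S).
Proof.
apply/idP/idP => [|sS].
  case/connectP=> p pp ->; apply/subsetP=> E; rewrite inE => /andP[_].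
  apply: contraR => nES; apply/connectP; exists p => //.
  apply: sub_path pp => a b /= /andP[eab abS]; rewrite /cut /= eab.
  by apply: contraNneq nES => <-.
have [p [pp up yp]] := simple_path x y.
move: sS; rewrite yp (sep_path pp up).1 => sS.
apply/connectP; exists p => //; elim: p x {up yp} pp sS => //= a p IH x.
rewrite walk_edges_cons subUset sub1set => /andP[exa pp] /andP[xaS sS].
by rewrite exa xaS IH.
Qed.

Lemma on_some_pathE (S : {set {set T}}) :
  on_some_path e S = [exists q : T * T, S \subset sep q.1 q.2].
Proof.
apply/existsP/existsP => [[n /existsP[t /and3P[pt ut St]]]|[[x y] /= Sxy]].
  exists (thead t, last (thead t) (behead t)); rewrite /=.
  by rewrite (sep_path pt _).1 //; case: (tupleP t) ut.
have [p [pp up yp]] := simple_path x y.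
have lt : size p < #|T|.
  by have := max_card (mem (x :: p)); rewrite (card_uniqP up).
exists (Ordinal lt); apply/existsP; exists (@Tuple _ T (x :: p) (eqxx _)).
by rewrite /thead (tnth_nth x) /= pp -(sep_path pp up).1 -yp Sxy andbT.
Qed.

(* In terms of sides: two distinct edges cannot cross, i.e. the four
   combinations of a side of [E0] and a side of [E1] are not all inhabited. *)
Lemma sep_no_crossing E0 E1 x y x' y' :
  E0 \in sep x x' -> E1 \notin sep x x' ->
  E0 \in sep y y' -> E1 \notin sep y y' -> E1 \notin sep x y.
Proof.
move=> E0x E1x E0y E1y.
have /edgesP[z [w [_ E0E]]] := subsetP (sep_edges x x') _ E0x.
have zE0 : z \in E0 by rewrite E0E !inE eqxx.
(* An end [z] of [E0] lies on both given paths, so [E1] separates it from neither [x] nor [y]. *)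
have /negPf nx : E1 \notin sep x z.
  by apply: contra E1x; apply/subsetP/(sub_sep_mem E0x).
have /negPf ny : E1 \notin sep y z.
  by apply: contra E1y; apply/subsetP/(sub_sep_mem E0y).
by rewrite (sep_addb _ x z) (sep_sym z) nx ny.
Qed.

(** * End edges of a path *)

(** This is the edge at the second argument [y]; the default [set0] occurs only for x = y. *)
Definition end_edge x y : {set T} :=
  odflt set0 [pick E in sep x y | y \in E].

Lemma end_edgeP x y : x != y -> end_edge x y \in sep x y /\ y \in end_edge x y.
Proof.
rewrite /end_edge => nxy; case: pickP => [E /andP[]|] //=.
by have [E Es yE] := sep_end_ex nxy => /(_ E); rewrite Es yE.
Qed.

Lemma end_edge_uniq x y E : E \in sep x y -> y \in E -> E = end_edge x y.
Proof.
move=> Es yE; have nxy : x != y.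
  by rewrite -sep_eq0; apply/set0Pn; exists E.
have [es ye] := end_edgeP nxy; exact: sep_end_uniq Es yE es ye.
Qed.

(** Root the tree at [r]: every vertex other than [r] owns the edge to its parent, namely
    [end_edge r z]. *)
Lemma card_edges : #|edges e| = #|T| - 1.
Proof.
have [r _] : exists r : T, r \in T.
  by apply/card_gt0P; case: tree_e => _ [].
have -> : edges e = [set end_edge r z | z in [set~ r]].
  apply/setP=> E; apply/idP/imsetP => [|[z]].
    case/edgesP=> u [w [euw EE]].
    (* Exactly one end of [E] is separated from [r] by [E]; that end is the child. *)
    have := sep_addb E r u w; rewrite (sep_edge euw) in_set1 -EE eqxx addbT.
    case Eu : (E \in sep r u) => Ew.
      exists u; last by apply: end_edge_uniq => //; rewrite EE !inE eqxx.
      by rewrite !inE -sep_eq0 sep_sym; apply/set0Pn; exists E.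
    exists w; last by apply: end_edge_uniq => //; rewrite EE !inE eqxx orbT.
    by rewrite !inE -sep_eq0 sep_sym; apply/set0Pn; exists E.
  rewrite !inE eq_sym => /end_edgeP[es _] ->.
  exact: (subsetP (sep_edges r z)) es.
rewrite card_in_imset => [|z z']; first by rewrite cardsC1 subn1.
rewrite !inE ![_ == r]eq_sym => /end_edgeP[es ze] /end_edgeP[es' ze'] eqE.
(* If the edge is shared by [z] and a different [z'], then [z'] is its other end [u]; but an edge
   separating [r] from both of its ends contradicts [sep_addb]. *)
have [u euz Eu] := edge_memP (subsetP (sep_edges r z) _ es) ze.
move: ze'; rewrite -eqE Eu !inE => /orP[/eqP z'u|/eqP //].
have es2 : end_edge r z \in sep r u by rewrite eqE -z'u.
by have := sep_addb (end_edge r z) r u z; rewrite es es2 (sep_edge euz) in_set1 Eu eqxx.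
Qed.

Lemma card_sep_eq1 x y : (#|sep x y| == 1) = e x y.
Proof.
apply/idP/idP => [/cards1P[E sE]|/sep_edge->]; last by rewrite cards1.
have nxy : x != y by rewrite -sep_eq0 sE; apply/set0Pn; exists E; rewrite inE.
have nyx : y != x by rewrite eq_sym.
have := end_edgeP nxy; have := end_edgeP nyx; rewrite (sep_sym y) sE.
rewrite !inE => -[/eqP-> xE] [/eqP-> yE].
have Ee : E \in edges e by apply: (subsetP (sep_edges x y)); rewrite sE inE.
have [u euy EE] := edge_memP Ee yE.
by move: xE; rewrite EE !inE (negPf nxy) orbF => /eqP->.
Qed.

(** * Pairs spanned by a set of edges *)

Definition spans x y (S : {set {set T}}) : bool :=
  [&& S \subset sep x y, end_edge x y \in S & end_edge y x \in S].

Lemma spans_sym x y S : spans x y S = spans y x S.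
Proof. by rewrite /spans sep_sym [in X in _ && X]andbC. Qed.

(** Take a pair at minimal distance whose path contains S: if an end edge were not in S, the end
    could be moved inwards across it. *)
Lemma spans_ex x y (S : {set {set T}}) : S != set0 -> S \subset sep x y ->
  exists x' y', spans x' y' S.
Proof.
move=> S0 Sxy.
case: (@arg_minnP _ (x, y) (fun q => S \subset sep q.1 q.2)
         (fun q => #|sep q.1 q.2|) Sxy) => -[{}x {}y] /= {}Sxy minS.
(* Stated for arbitrary [a] and [b] so that it serves both (x, y) and (y, x). *)
have end_mem a b : S \subset sep a b -> #|sep a b| <= #|sep x y| ->
    end_edge a b \in S.
  move=> Sab le_ab; apply: contraT => nS.
  have nab : a != b.
    by rewrite -sep_eq0; apply: contraNneq S0 => s0; rewrite -subset0 -s0.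
  have [es be] := end_edgeP nab.
  have [u eub Eu] := edge_memP (subsetP (sep_edges a b) _ es) be.
  have sE E : (E \in sep a b) = (E \in sep a u) (+) (E == end_edge a b).
    by rewrite (sep_addb E a u) (sep_edge eub) Eu in_set1.
  have Sau : S \subset sep a u.
    apply/subsetP=> E ES; have := subsetP Sab _ ES; rewrite sE.
    by have [EE|] := eqVneq E; [rewrite -EE ES in nS | rewrite addbF].
  have := minS (a, u) Sau; rewrite leqNgt; apply: contraNT => _ /=.
  apply: leq_trans le_ab; apply/proper_card/properP; split.
    by apply: sub_sep_mem es _; rewrite Eu !inE eqxx.
  by exists (end_edge a b) => //; have := es; rewrite sE eqxx addbT.
exists x, y; rewrite /spans Sxy !end_mem //; first by rewrite (sep_sym y).
by rewrite (sep_sym y).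
Qed.

Lemma spans_neq x y S : spans x y S -> x != y.
Proof.
case/and3P=> Sxy eS _; rewrite -sep_eq0; apply/set0Pn.
by exists (end_edge x y); apply: (subsetP Sxy).
Qed.

(** The vertex [x'] lies on the path from [x] to [y]. If it differs from [x], the path from [x] to
    [x'] starts with [end_edge y x], which is in S, against disjointness. *)
Lemma spans_eq_end x y x' y' S : spans x y S -> spans x' y' S ->
  [disjoint S & sep x x'] -> x = x'.
Proof.
move=> sxy sxy' dis; apply/eqP; apply: contraT => nxx'.
have /and3P[Sxy _ eS] := sxy; have /and3P[_ _ eS'] := sxy'.
have := spans_neq sxy'; rewrite eq_sym => /end_edgeP[_ x'e].
have /subsetP sub : sep x x' \subset sep x y.
  exact: sub_sep_mem (subsetP Sxy _ eS') x'e.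
rewrite eq_sym in nxx'; have [gs xg] := end_edgeP nxx'.
rewrite sep_sym in gs.
have ge : end_edge x' x = end_edge y x.
  by apply: end_edge_uniq xg; rewrite sep_sym sub.
by rewrite -(disjointFr dis eS) -ge gs.
Qed.

(** By [sep_no_crossing], the edges of S either all separate [x] from [x'] or none does. In each
    case [spans_eq_end], applied at both ends, matches the two pairs, reversed or not. *)
Lemma spans_uniq x y x' y' S : spans x y S -> spans x' y' S ->
  (x' = x /\ y' = y) \/ (x' = y /\ y' = x).
Proof.
move=> sxy sxy'.
have /and3P[/subsetP Sxy _ _] := sxy; have /and3P[/subsetP Sxy' _ _] := sxy'.
have Syy' E : E \in S -> (E \in sep y y') = (E \in sep x x').
  move=> ES; rewrite (sep_addb E y x) (sep_addb E x x') (sep_sym y x).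
  by rewrite Sxy // Sxy' // addbT addTb negbK.
have Sxy2 E : E \in S -> (E \in sep x y') = (E \notin sep x x').
  by move=> ES; rewrite (sep_addb E x x') Sxy' // addbT.
have Syx' E : E \in S -> (E \in sep y x') = (E \notin sep x x').
  by move=> ES; rewrite (sep_addb E y x) (sep_sym y x) Sxy.
have [dis|] := boolP [disjoint S & sep x x'].
  left; split; apply/esym; first exact: spans_eq_end sxy sxy' dis.
  rewrite spans_sym in sxy; rewrite spans_sym in sxy'.
  apply: spans_eq_end sxy sxy' _; rewrite disjoint_subset; apply/subsetP=> E ES.
  by rewrite inE Syy' // (disjointFr dis).
rewrite -setI_eq0 => /set0Pn[E0]; rewrite inE => /andP[E0S E0x].
have all_in E : E \in S -> E \in sep x x'.
  move=> ES; apply: contraT => nE.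
  have := sep_no_crossing E0x nE (_ : E0 \in sep y y') (_ : E \notin sep y y').
  by rewrite !Syy' // Sxy // => /(_ E0x nE).
right; split; apply/esym.
  rewrite spans_sym in sxy; apply: spans_eq_end sxy sxy' _.
  rewrite disjoint_subset; apply/subsetP=> E ES.
  by rewrite inE Syx' // all_in.
rewrite spans_sym in sxy'; apply: spans_eq_end sxy sxy' _.
rewrite disjoint_subset; apply/subsetP=> E ES.
by rewrite inE Sxy2 // all_in.
Qed.

(** Such a triple consists of the two end edges and one freely chosen interior edge. *)
Lemma card_spans3 x y : x != y ->
  #|[set S : {set {set T}} | (#|S| == 3) && spans x y S]| = #|sep x y| - 2.
Proof.
move=> nxy; have [cs yc] := end_edgeP nxy.
rewrite eq_sym in nxy; have [As xa] := end_edgeP nxy; rewrite sep_sym in As.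
rewrite /spans; set c := end_edge x y in cs yc *; set a := end_edge y x in As xa *.
(* Equal end edges mean that [x] and [y] are adjacent: there is no triple, and the truncated 1 - 2
   is 0. *)
have [ac|nac] := eqVneq a c.
  have [u euy cu] := edge_memP (subsetP (sep_edges x y) _ cs) yc.
  move: xa; rewrite ac cu !inE [x == y]eq_sym (negPf nxy) orbF => /eqP xu.
  rewrite -xu in euy; rewrite (sep_edge euy) cards1.
  apply/eqP; rewrite cards_eq0; apply/eqP/setP=> S; rewrite !inE.
  apply/negbTE/negP => /and3P[/eqP S3 /subset_leq_card].
  by rewrite S3 cards1.
have card_ac : #|[set a; c]| = 2 by rewrite cards2 nac.
have sub_ac : [set a; c] \subset sep x y by rewrite subUset !sub1set As cs.
have -> : [set S : {set {set T}} |
      (#|S| == 3) && [&& S \subset sep x y, c \in S & a \in S]] =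
    [set b |: [set a; c] | b in sep x y :\: [set a; c]].
  apply/setP=> S; rewrite inE; apply/idP/imsetP => [|[b]].
    case/and4P=> S3 Sxy cS aS.
    have acS : [set a; c] \subset S by rewrite subUset !sub1set aS cS.
    have : #|S :\: [set a; c]| == 1.
      by rewrite cardsD (setIidPr acS) card_ac (eqP S3).
    case/cards1P=> b Sb; exists b.
      by apply: (subsetP (setSD _ Sxy)); rewrite Sb inE.
    by rewrite -Sb setUC -[LHS](setID S [set a; c]) (setIidPr acS).
  rewrite in_setD => /andP[nb bs] ->.
  rewrite cardsU1 nb card_ac subUset sub1set bs sub_ac /=.
  by rewrite !inE !eqxx !orbT.
rewrite card_in_imset ?cardsD ?(setIidPr sub_ac) ?card_ac // => b b'.
rewrite !in_setD => /andP[nb _] /andP[nb' _] eqb.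
have := setU11 b [set a; c]; rewrite eqb in_setU1 (negPf nb) orbF.
by move/eqP.
Qed.

(** * Counting pairs and triples *)

Definition ordered_pairs : {set T * T} :=
  [set q : T * T | enum_rank q.1 < enum_rank q.2].

Lemma ordered_pairs_neq q : q \in ordered_pairs -> q.1 != q.2.
Proof. by rewrite inE; apply: contraTneq => ->; rewrite ltnn. Qed.

Lemma ordered_pairs_total x y : x != y ->
  ((y, x) \in ordered_pairs) = ((x, y) \notin ordered_pairs).
Proof.
move=> nxy; rewrite !inE /= -leqNgt [RHS]leq_eqVlt.
by rewrite (inj_eq (@ord_inj _)) (inj_eq enum_rank_inj) eq_sym (negPf nxy).
Qed.

(** The square splits into the ordered pairs, their swaps and the diagonal. *)
Lemma card_ordered_pairs : 2 * #|ordered_pairs| + #|T| = #|T| ^ 2.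
Proof.
rewrite -mulnn -card_prod -(cardsT {: T * T}) mul2n -addnn.
pose sw (q : T * T) := (q.2, q.1).
have swI : injective sw by case=> a b [c d] [-> ->].
have -> : [set: T * T] =
    ordered_pairs :|: sw @: ordered_pairs :|: [set (x, x) | x in T].
  apply/setP=> -[x y]; rewrite in_setT; apply/esym; rewrite !in_setU.
  have [->|nxy] := eqVneq x y.
    by rewrite [X in _ || X](_ : _ = true) ?orbT //; apply/imsetP; exists y.
  have -> : (x, y) = sw (y, x) by [].
  rewrite (mem_imset _ _ swI) /sw /= -/(sw (x, y)) /sw /=.
  by rewrite (ordered_pairs_total nxy) orbN.
have sw_mem x y : ((x, y) \in sw @: ordered_pairs) = ((y, x) \in ordered_pairs).
  by rewrite -[(x, y)]/(sw (y, x)) (mem_imset _ _ swI).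
rewrite !cardsU (card_imset _ swI) card_imset; last by move=> ? ? [].
have -> : ordered_pairs :&: sw @: ordered_pairs = set0.
  apply/setP=> -[x y]; rewrite in_setI sw_mem in_set0.
  have [->|nxy] := eqVneq x y; first by rewrite !inE ltnn.
  by rewrite (ordered_pairs_total nxy) andbN.
have -> : (ordered_pairs :|: sw @: ordered_pairs) :&: [set (x, x) | x in T] = set0.
  apply/setP=> -[x y]; rewrite in_set0 in_setI; apply/negbTE/andP=> -[h /imsetP[z _ [xz yz]]].
  by move: h; rewrite xz yz in_setU sw_mem !inE ltnn.
by rewrite cards0 !subn0.
Qed.

Lemma wiener_sep : wiener e = \sum_(q in ordered_pairs) #|sep q.1 q.2|.
Proof.
rewrite /wiener pair_big_dep /=; apply: eq_big => q; first by rewrite inE.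
by rewrite gdist_sep.
Qed.

(** The order by [enum_rank] selects one orientation of each edge. *)
Lemma card_adjacent_pairs :
  #|[set q in ordered_pairs | e q.1 q.2]| = #|T| - 1.
Proof.
rewrite -card_edges.
have -> : edges e =
    [set [set q.1; q.2] | q : T * T in [set q in ordered_pairs | e q.1 q.2]].
  apply/setP=> E; apply/edgesP/imsetP => [[x [y [exy ->]]]|[[x y]]].
    have nxy : x != y by apply: contraTneq exy => ->; rewrite tree_irr.
    have [o|o] := boolP ((x, y) \in ordered_pairs).
      by exists (x, y); rewrite // in_set o.
    rewrite -ordered_pairs_total // in o.
    by exists (y, x); rewrite 1?setUC // in_set o /= tree_sym.
  by rewrite in_set => /andP[_ exy] ->; exists x, y.
rewrite card_in_imset // => -[x y] [x' y'].
rewrite in_set => /andP[o _]; rewrite in_set => /andP[o' _] /= eqE.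
have nxy := ordered_pairs_neq o; have nxy' := ordered_pairs_neq o'.
have: x \in [set x'; y'] by rewrite -eqE !inE eqxx.
have: y \in [set x'; y'] by rewrite -eqE !inE eqxx orbT.
rewrite !inE => /orP[] /eqP y_ /orP[] /eqP x_.
- by move: nxy; rewrite x_ y_ eqxx.
- by move: o; rewrite x_ y_ /= (ordered_pairs_total nxy') o'.
- by rewrite x_ y_.
- by move: nxy; rewrite x_ y_ eqxx.
Qed.

(** Double counting of the incidences [spans x y S]: [card_spans3] counts them by pairs, while each
    triple on a path has exactly one ordered spanning pair. *)
Lemma card_path_triples :
  \sum_(q in ordered_pairs) (#|sep q.1 q.2| - 2) =
  #|[set S : {set {set T}} |
      [&& S \subset edges e, #|S| == 3 & on_some_path e S]]|.
Proof.
under eq_bigr => q /ordered_pairs_neq nq.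
  rewrite -(card_spans3 nq) -sum1_card.
  under eq_bigl => S do rewrite inE.
  over.
rewrite -sum1_card.
rewrite (exchange_big_dep (fun S : {set {set T}} =>
   S \in [set S : {set {set T}} | [&& S \subset edges e, #|S| == 3 & on_some_path e S]])) /=.
  apply: eq_bigr => S; rewrite inE on_some_pathE.
  case/and3P=> _ S3 /existsP[[x y] /= Sxy].
  have S0 : S != set0 by rewrite -cards_eq0 (eqP S3).
  have [x' [y' sxy]] := spans_ex S0 Sxy.
  have {x y Sxy x' y' sxy} [x [y [o sxy]]] :
      exists x y, (x, y) \in ordered_pairs /\ spans x y S.
    have [o|o] := boolP ((x', y') \in ordered_pairs); first by exists x', y'.
    exists y', x'; split; last by rewrite spans_sym.
    by rewrite ordered_pairs_total // (spans_neq sxy).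
  rewrite (big_pred1 (x, y)) // => -[x' y'] /=; rewrite S3 /=.
  apply/andP/eqP => [[o' sxy']|[-> ->]] //.
  case: (spans_uniq sxy sxy') => -[ex ey]; first by rewrite ex ey.
  move: o'; rewrite ex ey ordered_pairs_total ?o //; exact: spans_neq sxy.
move=> [x y] S _ /andP[S3 /and3P[/= Sxy _ _]].
rewrite inE S3 on_some_pathE (subset_trans Sxy) ?sep_edges //=.
by apply/existsP; exists (x, y).
Qed.

Lemma wiener_triples :
  wiener e = (#|T| - 1) ^ 2 + #|[set S : {set {set T}} |
          [&& S \subset edges e, #|S| == 3 & on_some_path e S]]|.
Proof.
rewrite -card_path_triples wiener_sep.
have T0 : 0 < #|T| by case: tree_e => _ [].
(* For a distance d > 0, truncated subtraction gives (d - 2) + 2 = d + [d = 1], and d = 1 means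
   adjacency. *)
have : \sum_(q in ordered_pairs) (#|sep q.1 q.2| - 2) + 2 * #|ordered_pairs| =
       \sum_(q in ordered_pairs) #|sep q.1 q.2| + (#|T| - 1).
  rewrite -card_adjacent_pairs -!sum1_card mulnC big_distrl /= -big_split /=.
  under [X in _ + X]eq_bigl => q do rewrite in_set.
  rewrite big_mkcondr -big_split /=; apply: eq_bigr => q /ordered_pairs_neq.
  rewrite -sep_eq0 -cards_eq0 -card_sep_eq1.
  by case: #|_| => [|[|k]] //= _; rewrite addn0 subn2 /= mul1n addn2.
(* Twice the number of ordered pairs is v(v-1), and v(v-1) - (v-1) = (v-1)^2. *)
move: card_ordered_pairs.
case: #|T| T0 => // n _; rewrite subn1 /= -(addn1 n) sqrnD; lia.
Qed.

(** * Contractions onto P_4 *)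

(** The edge {i, i+1} of P_4, given through numerical values so that incidence reduces to
    arithmetic. *)
Definition segment (i : nat) : {set 'I_4} :=
  [set k : 'I_4 | (k == i :> nat) || (k == i.+1 :> nat)].

Definition P4_edges : {set {set 'I_4}} :=
  [set [set (inord 0 : 'I_4); inord 1];
       [set (inord 1 : 'I_4); inord 2];
       [set (inord 2 : 'I_4); inord 3]].

Lemma P4_edgesE : P4_edges = [set segment (i : 'I_3) | i : 'I_3].
Proof.
have segE i : i < 3 -> [set (inord i : 'I_4); inord i.+1] = segment i.
  move=> i3; apply/setP=> k; rewrite !inE -!val_eqE /= !inordK //.
  exact: ltnW.
rewrite /P4_edges !segE //; apply/setP=> A; apply/idP/imsetP => [|[i _ ->]].
  rewrite !inE -orbA => /or3P[] /eqP->.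
  - by exists (inord 0); rewrite ?inordK.
  - by exists (inord 1); rewrite ?inordK.
  - by exists (inord 2); rewrite ?inordK.
by case: i => -[|[|[|//]]] ?; rewrite !inE eqxx ?orbT.
Qed.

Lemma segment_inj (i j : nat) : i < 3 -> j < 3 -> segment i = segment j -> i = j.
Proof.
move=> i3 j3 /setP eqs.
have := eqs (inord i); have := eqs (inord j); have := eqs (inord i.+1).
by rewrite !inE !inordK; lia.
Qed.

Lemma card_P4_edges : #|P4_edges| = 3.
Proof.
rewrite P4_edgesE card_imset ?card_ord // => i j /segment_inj eqij.
by apply/val_inj/eqij.
Qed.

(** The path found joins a vertex labelled 0 to one labelled 3: each uncontracted edge is the only
    one leaving some set of vertices with label at most i < 3. *)
Lemma contracts_to_P4_path (S : {set {set T}}) :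
  contracts_to_P4 e S -> on_some_path e (edges e :\: S).
Proof.
case/existsP=> f /and3P[/forallP fibres /eqP card3]; rewrite -/P4_edges => /eqP fF.
(* A map from three edges onto three edges is injective. *)
have injF : {in edges e :\: S &, injective (fun E : {set T} => f @: E)}.
  by apply/imset_injP; rewrite fF card_P4_edges card3.
have onto i (k : 'I_4) : i < 3 -> k \in segment i -> exists x, f x = k.
  move=> i3 ki; have : segment i \in P4_edges.
    by rewrite P4_edgesE; apply/imsetP; exists (Ordinal i3).
  rewrite -fF => /imsetP[E _ eqE]; move: ki; rewrite eqE => /imsetP[x _ ->].
  by exists x.
have [x fx] : exists x, f x = inord 0 by apply: (onto 0) => //; rewrite inE inordK.
have [y fy] : exists y, f y = inord 3 by apply: (onto 2) => //; rewrite inE inordK.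
have {}fx : f x = 0 :> nat by rewrite fx inordK.
have {}fy : f y = 3 :> nat by rewrite fy inordK.
have seg_of E : E \in edges e :\: S -> exists2 i, i < 3 & f @: E = segment i.
  move=> EF; have : f @: E \in P4_edges by rewrite -fF imset_f.
  by rewrite P4_edgesE => /imsetP[i _ ->]; exists i.
rewrite on_some_pathE; apply/existsP; exists (x, y) => /=.
apply/subsetP=> E EF; have [i i3 fE] := seg_of E EF.
rewrite inE; move: (EF); rewrite inE => /andP[_ ->] /=; apply/negP=> cxy.
(* Contracted edges preserve the label, and the other remaining edges lie over segments j different
   from i, so none passes between i and i+1. *)
have clA : closed (cut E) [pred z | f z <= i].
  apply: intro_closed => [|a b /andP[/= eab nabE]]; first exact: cut_csym.
  rewrite !inE; case abS : ([set a; b] \in S).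
    have /eqP-> // : f a == f b.
    by rewrite (eqP (forallP (fibres a) b)) connect1 //= eab abS.
  have abF : [set a; b] \in edges e :\: S by rewrite inE abS mem_edges.
  have [j j3 fab] := seg_of _ abF.
  have nij : i != j.
    by apply: contraNneq nabE => ij; apply/eqP/injF; rewrite // fab fE ij.
  have : f a \in segment j by rewrite -fab imset_f // !inE eqxx.
  have : f b \in segment j by rewrite -fab imset_f // !inE eqxx orbT.
  by rewrite !inE => /orP[]/eqP-> /orP[]/eqP->; lia.
by have := closed_connect clA cxy; rewrite !inE; lia.
Qed.

(** The label [rk z] counts the edges of F crossed on the way from [x] to [z]. *)
Lemma path_contracts_to_P4 (S : {set {set T}}) :
  #|edges e :\: S| = 3 -> on_some_path e (edges e :\: S) -> contracts_to_P4 e S.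
Proof.
set F := edges e :\: S => card3; rewrite on_some_pathE => /existsP[[x y] /= Fxy].
pose rk z := #|sep x z :&: F|.
have rk_le z : rk z < 4 by rewrite ltnS -card3 subset_leq_card ?subsetIr.
(* The sets [sep x z :&: F] form a chain: edges [E0] and [E1] witnessing incomparability would make
   [sep_no_crossing] exclude [E1] from [sep x y]. Hence the label determines the set. *)
have rk_sub z w : rk z = rk w -> sep x z :&: F \subset sep x w :&: F.
  move=> eqr; apply: contraT => nzw.
  have /subsetPn[E1 E1w E1z] : ~~ (sep x w :&: F \subset sep x z :&: F).
    apply: contra nzw => wz; have/eqP-> // : sep x w :&: F == sep x z :&: F.
    by rewrite eqEcard wz -/(rk z) -/(rk w) eqr leqnn.
  have /subsetPn[E0 E0z E0w] := nzw.
  move: E0z E0w E1w E1z; rewrite !in_setI => /andP[E0z E0F]; rewrite E0F andbT => E0w.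
  case/andP=> E1w E1F; rewrite E1F andbT => E1z.
  have E0y := subsetP Fxy _ E0F; have E1y := subsetP Fxy _ E1F.
  suff: E1 \notin sep x y by rewrite E1y.
  apply: (sep_no_crossing (y' := w) E0z E1z).
    by rewrite (sep_addb _ y x) (sep_sym y) E0y (negPf E0w).
  by rewrite (sep_addb _ y x) (sep_sym y) E1y E1w.
have rk_inj z w : rk z = rk w -> sep x z :&: F = sep x w :&: F.
  by move=> eqr; apply/eqP; rewrite eqEsubset !rk_sub.
(* Crossing an edge of F away from [x] raises the label by one. *)
have orient E : E \in F ->
    exists u w, [/\ E = [set u; w], E \notin sep x u,
      sep x w :&: F = E |: (sep x u :&: F) & rk w = (rk u).+1].
  move=> EF; have oriented u w : e u w -> E = [set u; w] -> E \notin sep x u ->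
      sep x w :&: F = E |: (sep x u :&: F) /\ rk w = (rk u).+1.
    move=> euw Euw nE; suff sw : sep x w :&: F = E |: (sep x u :&: F).
      by rewrite /rk sw cardsU1 in_setI (negPf nE).
    apply/setP=> E'; rewrite in_setU1 !in_setI (sep_addb _ x u) (sep_edge euw).
    rewrite -Euw in_set1; have [->|] := eqVneq E' E; last by rewrite addbF.
    by rewrite (negPf nE) EF.
  have /edgesP[u [w [euw Euw]]] : E \in edges e by move: EF; rewrite inE => /andP[].
  have [Eu|nEu] := boolP (E \in sep x u); last first.
    by have [? ?] := oriented u w euw Euw nEu; exists u, w.
  have ewu : e w u by rewrite tree_sym.
  have Ewu : E = [set w; u] by rewrite setUC.
  have nEw : E \notin sep x w.
    by rewrite (sep_addb _ x u) Eu (sep_edge euw) -Euw in_set1 eqxx.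
  by have [? ?] := oriented w u ewu Ewu nEw; exists w, u.
pose f := [ffun z => Ordinal (rk_le z)].
have f_segment u w : rk w = (rk u).+1 -> rk u < 3 /\ f @: [set u; w] = segment (rk u).
  move=> rw; split; first by rewrite -ltnS -rw.
  by apply/setP=> k; rewrite imsetU1 imset_set1 !inE !ffunE -!val_eqE /= rw.
apply/existsP; exists f; apply/and3P; split.
- apply/'forall_forallP => z w; apply/eqP; rewrite connect_sub_sep.
  (* Equal labels mean equal F-parts of [sep x z] and [sep x w], that is, no edge of F in their
     symmetric difference [sep z w]. *)
  rewrite !ffunE -val_eqE /=; apply/eqP/subsetP => [/rk_inj eqzw E Ezw|zwS].
    apply: contraT => nES; have EF : E \in F.
      by rewrite inE nES (subsetP (sep_edges z w)).
    have /setP/(_ E) := eqzw; rewrite !in_setI EF !andbT.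
    by rewrite (sep_addb E x z w) Ezw addbT; case: (_ \in _).
  congr #|pred_of_set _|; apply/setP=> E; rewrite !in_setI.
  have [EF|] := boolP (E \in F); rewrite ?andbF // !andbT.
  rewrite (sep_addb E x z w); have [/zwS ES|] := boolP (E \in sep z w).
    by move: EF; rewrite inE ES.
  by rewrite addbF.
- by rewrite card3.
rewrite -/P4_edges eqEcard card_P4_edges; apply/andP; split.
  apply/subsetP=> _ /imsetP[E /orient[u [w [-> _ _ /f_segment[u3 ->]]]] ->].
  by rewrite P4_edgesE; apply/imsetP; exists (Ordinal u3).
(* After the inclusion, injectivity suffices by cardinality. Two edges over one segment have equal
   labels at their near and far ends, so adding either edge to the same set A gives the same result,
   with neither in A. *)
rewrite card_in_imset ?card3 // => E E' /orient[u [w [Euw nE sw rw]]].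
case/orient=> u' [w' [Euw' nE' sw' rw']].
have [u3 fu] := f_segment _ _ rw; have [u3' fu'] := f_segment _ _ rw'.
rewrite {1}Euw {1}Euw' fu fu' => /segment_inj equ.
have {}equ : rk u = rk u' by apply: equ.
have eqw : rk w = rk w' by rewrite rw rw' equ.
have : E \in sep x w :&: F by rewrite sw setU11.
rewrite (rk_inj _ _ eqw) sw' -(rk_inj _ _ equ) in_setU1 in_setI (negPf nE) orbF.
by move/eqP.
Qed.

(** Complementation in the edge set, which has v - 1 elements, is a bijection between the two
    families. *)
Lemma card_P4_contractions : 4 <= #|T| ->
  #|[set S : {set {set T}} |
      [&& S \subset edges e, #|S| == #|T| - 4 & contracts_to_P4 e S]]| =
  #|[set S : {set {set T}} |
      [&& S \subset edges e, #|S| == 3 & on_some_path e S]]|.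
Proof.
move=> T4; set A := [set S | _]; set B := [set S | _].
have compl (S : {set {set T}}) : S \subset edges e ->
    edges e :\: (edges e :\: S) = S /\ #|S| + #|edges e :\: S| = #|T| - 1.
  move=> SE; rewrite setDDr setDv set0U (setIidPr SE); split=> //.
  by rewrite -card_edges -(cardsID S (edges e)) (setIidPr SE).
have -> : A = [set edges e :\: S | S in B].
  apply/setP=> S; rewrite inE; apply/idP/imsetP => [|[F]].
    case/and3P=> SE /eqP Sc cS; have [SK card] := compl S SE.
    exists (edges e :\: S) => //; rewrite inE subsetDl contracts_to_P4_path //.
    (* Here v >= 4 makes v - 4 an honest difference, so the complement has three edges. *)
    by rewrite andbT; apply/eqP; lia.
  rewrite inE => /and3P[FE /eqP F3 pF] ->; have [FK card] := compl F FE.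
  rewrite subsetDl path_contracts_to_P4 ?FK //.
  by rewrite andbT; apply/eqP; lia.
apply: card_in_imset => F F'; rewrite !inE => /and3P[/compl[FK _] _ _].
by case/and3P=> /compl[FK' _] _ _ eqF; rewrite -FK eqF.
Qed.

End Separation.

Theorem theorem4p6 (T : finType) (e : rel T) :
  is_tree e ->
  (wiener e = (#|T| - 1) ^ 2 +
     #|[set S : {set {set T}} |
          [&& S \subset edges e, #|S| == 3 & on_some_path e S]]|) /\
  (4 <= #|T| ->
   wiener e = (#|T| - 1) ^ 2 +
     #|[set S : {set {set T}} |
          [&& S \subset edges e, #|S| == #|T| - 4 & contracts_to_P4 e S]]|).
Proof.
move=> tree_e; split=> [|T4]; first exact: wiener_triples.
by rewrite card_P4_contractions // wiener_triples.
Qed.
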